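(* Let $\mathcal{A}$ be a symmetric Banach algebra and let $\delta$ be a symmetric derivation on $\mathcal{A}$ with domain $\mathcal{D}(\delta)$. If $\mathbf{1}\in\mathcal{D}(\delta)$, then $\mathcal{D}(\delta)$ is inverse-closed in $\mathcal{A}$ and $\mathcal{D}(\delta)$ is a symmetric Banach algebra. Moreover, for every $a\in\mathcal{D}(\delta)$ that is invertible in $\mathcal{A}$, the quotient rule $$\delta(a^{-1})=-a^{-1}\delta(a)a^{-1}$$ is valid and $$\|a^{-1}\|_{\mathcal{D}(\delta)}\le\|a^{-1}\|_{\mathcal{A}}^2\,\|a\|_{\mathcal{D}(\delta)} .$$
   Context: All Banach algebras are complex and unital with unit $\mathbf{1}$. A symmetric Banach algebra is a Banach $*$-algebra $\mathcal{A}$ in which $\sigma_{\mathcal{A}}(a^*a)\subseteq[0,\infty)$ for all $a\in\mathcal{A}$, where $\sigma_{\mathcal{A}}$ denotes the spectrum in $\mathcal{A}$. A derivation on $\mathcal{A}$ is a closed linear map $\delta:\mathcal{D}(\delta)\to\mathcal{A}$, where the domain $\mathcal{D}(\delta)$ is a linear subspace of $\mathcal{A}$ (not necessarily closed or dense), satisfying the Leibniz rule $\delta(ab)=a\delta(b)+\delta(a)b$ for all $a,b\in\mathcal{D}(\delta)$ (in particular $\mathcal{D}(\delta)$ is closed under products). It is symmetric if $\mathcal{D}(\delta)=\mathcal{D}(\delta)^*$ and $\delta(a^* )=\delta(a)^*$ for all $a\in\mathcal{D}(\delta)$. The domain carries the graph norm $\|a\|_{\mathcal{D}(\delta)}=\|a\|_{\mathcal{A}}+\|\delta(a)\|_{\mathcal{A}}$,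 for which it is a Banach algebra. For Banach algebras $\mathcal{A}\subseteq\mathcal{B}$ with common unit, $\mathcal{A}$ is inverse-closed in $\mathcal{B}$ if $a\in\mathcal{A}$ and $a^{-1}\in\mathcal{B}$ imply $a^{-1}\in\mathcal{A}$. *)

(* Defs.v *)
From HB Require Import structures.
From mathcomp Require Import all_boot all_order all_algebra.
From mathcomp Require Import all_classical all_reals.
From mathcomp Require Import topology normedtype.

Set Implicit Arguments.
Unset Strict Implicit.
Unset Printing Implicit Defensive.

Import Order.TTheory GRing.Theory Num.Theory.
Import numFieldNormedType.Exports.

Local Open Scope classical_set_scope.
Local Open Scope ring_scope.

(* Hierarchy-Builder rejects a structure extending both NormedModule and a
   ring structure, because Num.NumDomain, which already joins a norm with a
   ring, would have to inherit from it. The norm is therefore an operation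
   anorm of its own, with the axioms of Lmodule_isNormed, and the normed module
   it defines lives on the alias normed_space.
   The normalization anorm 1 = 1 is not required. Units and inverses are those
   of unitRingType: a is a unit iff it has a two-sided inverse. *)
HB.mixin Record Algebra_hasNorm (K : numFieldType) A
    & GRing.UnitAlgebra K A := {
  anorm : A -> K;
  ler_anormD : forall a b, anorm (a + b) <= anorm a + anorm b;
  anormZ : forall (c : K) a, anorm (c *: a) = `|c| * anorm a;
  anorm0_eq0 : forall a, anorm a = 0 -> a = 0;
  ler_anormM : forall a b, anorm (a * b) <= anorm a * anorm b
}.

#[short(type="normedAlgType")]
HB.structure Definition NormedAlgebra (K : numFieldType) :=
  {A of GRing.UnitAlgebra K A & Algebra_hasNorm K A}.

Definition normed_space (K : numFieldType) (A : normedAlgType K) : Type := A.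

HB.instance Definition _ (K : numFieldType) (A : normedAlgType K) :=
  GRing.Lmodule.on (normed_space A).
HB.instance Definition _ (K : numFieldType) (A : normedAlgType K) :=
  Lmodule_isNormed.Build K (normed_space A)
    (@ler_anormD K A) (@anormZ K A) (@anorm0_eq0 K A).

HB.mixin Record NormedAlgebra_isComplete (K : numFieldType) A
    & NormedAlgebra K A := {
  anorm_complete : forall F : set_system (normed_space A),
    ProperFilter F -> cauchy F -> cvg F
}.

#[short(type="banachAlgType")]
HB.structure Definition BanachAlgebra (K : numFieldType) :=
  {A of NormedAlgebra K A & NormedAlgebra_isComplete K A}.

HB.instance Definition _ (K : numFieldType) (A : banachAlgType K) :=
  Uniform_isComplete.Build (normed_space A) (@anorm_complete K A).

HB.mixin Record hasInvolution (K : numClosedFieldType) A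
    & BanachAlgebra K A := {
  star : A -> A;
  starK : involutive star;
  starD : forall a b, star (a + b) = star a + star b;
  starZ : forall (c : K) a, star (c *: a) = c^* *: star a;
  starM : forall a b, star (a * b) = star b * star a;
  anorm_star : forall a, anorm (star a) = anorm a
}.

#[short(type="banachStarAlgType")]
HB.structure Definition BanachStarAlgebra (K : numClosedFieldType) :=
  {A of BanachAlgebra K A & hasInvolution K A}.

Definition spectrum (K : numFieldType) (A : banachAlgType K) (a : A) : set K :=
  [set z | a - z%:A \isn't a GRing.unit].

(* In the partial order of a numClosedFieldType, 0 <= z means that z is real
   and nonnegative. *)
Definition symmetric_algebra (K : numClosedFieldType)
    (A : banachStarAlgType K) : Prop :=
  forall a : A, spectrum (star a * a) `<=` [set z | 0 <= z].

Definition inverse_closed (K : numFieldType) (A : banachAlgType K)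
    (B : {pred A}) : Prop :=
  forall a : A, a \in B -> a \is a GRing.unit -> a^-1 \in B.

(* A partially defined operator is encoded by its domain and a total function
   whose values outside the domain are irrelevant. *)
Record derivation (K : numFieldType) (A : banachAlgType K) := Derivation {
  dom : {pred A};
  der :> A -> A;
  dom_submod : submod_closed dom;
  der_linear : forall (c : K) a b, a \in dom -> b \in dom ->
    der (c *: a + b) = c *: der a + der b;
  domM : forall a b, a \in dom -> b \in dom -> a * b \in dom;
  derM : forall a b, a \in dom -> b \in dom ->
    der (a * b) = a * der b + der a * b;
  der_closed : closed
    [set p : normed_space A * normed_space A | p.1 \in dom /\ p.2 = der p.1]
}.

Definition symmetric_derivation (K : numClosedFieldType)
    (A : banachStarAlgType K) (d : derivation A) : Prop :=
  (forall a, (star a \in dom d) = (a \in dom d)) /\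
  (forall a, a \in dom d -> d (star a) = star (d a)).

Definition graph_norm (K : numFieldType) (A : banachAlgType K)
    (d : derivation A) (a : A) : K := anorm a + anorm (d a).

(* The domain of a symmetric derivation, with the algebra operations and the
   involution of A and with the graph norm, as a Banach *-algebra. *)
Record graph_algebra (K : numClosedFieldType) (A : banachStarAlgType K)
    (d : derivation A) (ds : symmetric_derivation d) (d1 : 1 \in dom d) :=
  GraphAlgebra { graph_val : A; graph_valP : graph_val \in dom d }.

Section GraphAlgebraTheory.
Variables (K : numClosedFieldType) (A : banachStarAlgType K).
Variables (d : derivation A) (ds : symmetric_derivation d).
Variable d1 : 1 \in dom d.
Local Notation D := (graph_algebra ds d1).

HB.instance Definition _ := [isSub of D for @graph_val K A d ds d1].
HB.instance Definition _ := [Choice of D by <:].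

Lemma dom_subring : subring_closed (dom d).
Proof.
have [d0 dl] := dom_submod d.
split=> // [a b da db|]; last exact: domM.
by rewrite addrC -scaleN1r; apply: dl.
Qed.

HB.instance Definition _ :=
  GRing.SubChoice_isSubNzRing.Build A (dom d) D dom_subring.
HB.instance Definition _ :=
  GRing.SubZmodule_isSubLmodule.Build K A (dom d) D (dom_submod d).
HB.instance Definition _ :=
  GRing.SubNzRing_SubLmodule_isSubLalgebra.Build K A (dom d) D.
HB.instance Definition _ :=
  GRing.SubLalgebra_isSubAlgebra.Build K A (dom d) D.

Definition graph_inverse_of (x y : D) : Prop := y * x = 1 /\ x * y = 1.
Definition graph_unit (x : D) : bool := `[< exists y, graph_inverse_of x y >].
Definition graph_inv (x : D) : D :=
  if pselect (exists y, graph_inverse_of x y) is left h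
  then sval (cid h) else x.

Lemma graph_invP (x : D) : graph_unit x -> graph_inverse_of x (graph_inv x).
Proof.
move=> /asboolP ux; rewrite /graph_inv.
by case: pselect => // h; case: (cid h).
Qed.

Fact graph_mulVr : {in graph_unit, left_inverse 1 graph_inv *%R}.
Proof. by move=> x /graph_invP[]. Qed.
Fact graph_mulrV : {in graph_unit, right_inverse 1 graph_inv *%R}.
Proof. by move=> x /graph_invP[]. Qed.
Fact graph_unitrP (x y : D) : y * x = 1 /\ x * y = 1 -> graph_unit x.
Proof. by move=> yx; apply/asboolP; exists y. Qed.
Fact graph_invr_out : {in [predC graph_unit], graph_inv =1 id}.
Proof.
move=> x /negP ux; rewrite /graph_inv; case: pselect => // h.
by case: ux; apply/asboolP.
Qed.

HB.instance Definition _ := GRing.NzRing_hasMulInverse.Build D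
  graph_mulVr graph_mulrV graph_unitrP graph_invr_out.

Fact der0 : d 0 = 0.
Proof.
have [d0 _] := dom_submod d.
by have := der_linear 1 d0 d0; rewrite !scale1r addr0 => /eqP;
  rewrite -{1}[d 0]addr0 (inj_eq (addrI _)) eq_sym => /eqP.
Qed.
Lemma derD a b : a \in dom d -> b \in dom d -> d (a + b) = d a + d b.
Proof. by move=> da db; rewrite -{1}[a]scale1r der_linear// scale1r. Qed.
Lemma derZ (c : K) a : a \in dom d -> d (c *: a) = c *: d a.
Proof.
have [d0 _] := dom_submod d.
by move=> da; rewrite -{1}[c *: a]addr0 der_linear// der0 addr0.
Qed.

Lemma anorm_ge0 (a : A) : 0 <= anorm a.
Proof. exact: (@normr_ge0 K (normed_space A)). Qed.

Definition graph_anorm (x : D) : K := graph_norm d (val x).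

Fact ler_graph_anormD (x y : D) :
  graph_anorm (x + y) <= graph_anorm x + graph_anorm y.
Proof.
rewrite /graph_anorm /graph_norm raddfD/= derD ?graph_valP//.
by rewrite addrACA lerD// ler_anormD.
Qed.
Fact graph_anormZ (c : K) (x : D) :
  graph_anorm (c *: x) = `|c| * graph_anorm x.
Proof.
by rewrite /graph_anorm /graph_norm linearZ/= derZ ?graph_valP// !anormZ mulrDr.
Qed.
Fact graph_anorm0_eq0 (x : D) : graph_anorm x = 0 -> x = 0.
Proof.
move=> /eqP; rewrite /graph_anorm /graph_norm paddr_eq0 ?anorm_ge0//.
by case/andP=> /eqP/anorm0_eq0 x0 _; apply: val_inj; rewrite raddf0.
Qed.
Fact ler_graph_anormM (x y : D) :
  graph_anorm (x * y) <= graph_anorm x * graph_anorm y.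
Proof.
rewrite /graph_anorm /graph_norm rmorphM/= derM ?graph_valP//.
set a := graph_val x; set b := graph_val y.
apply: (@le_trans _ _ (anorm a * anorm b
    + (anorm a * anorm (d b) + anorm (d a) * anorm b))).
  apply: lerD; first exact: ler_anormM.
  by apply: le_trans (ler_anormD _ _) _; apply: lerD; exact: ler_anormM.
by rewrite mulrDl !mulrDr !addrA lerDl mulr_ge0 ?anorm_ge0.
Qed.

HB.instance Definition _ := Algebra_hasNorm.Build K D
  ler_graph_anormD graph_anormZ graph_anorm0_eq0 ler_graph_anormM.

Let N := normed_space D.
Let M := normed_space A.

Fact graph_complete (F : set_system N) :
  ProperFilter F -> cauchy F -> cvg F.
Proof.
move=> FF /cauchyP Fc.
pose f (x : N) : M := graph_val x.
pose g (x : N) : M := d (graph_val x).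
have distE (x y : N) : `|x - y| = `|f x - f y| + `|g x - g y|.
  rewrite -[LHS]/(graph_norm d (graph_val x - graph_val y)).
  rewrite /graph_norm -scaleN1r derD ?derZ ?graph_valP//; last first.
    by have [d0 dl] := dom_submod d; rewrite -[_ *: _]addr0 dl ?graph_valP.
  by rewrite !scaleN1r.
have cauchy_dom (h : N -> M) : (forall x y, `|h x - h y| <= `|x - y|) ->
    cauchy (h @ F).
  move=> hle; apply/cauchyP => e e0; have [x Fx] := Fc e e0.
  exists (h x); rewrite /fmap/=; apply: (@filterS _ F _ (ball x e) _ _ Fx) => y.
  rewrite /preimage/= -!ball_normE/=.
  by apply: le_lt_trans; exact: hle.
have [a Fa] : exists a : M, f @ F --> a.
  apply/cvg_ex; apply: cauchy_cvg; apply: cauchy_dom => x y.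
  by rewrite distE lerDl.
have [b Fb] : exists b : M, g @ F --> b.
  apply/cvg_ex; apply: cauchy_cvg; apply: cauchy_dom => x y.
  by rewrite distE lerDr.
have Fab : (f x, g x) @[x --> F] --> (a, b).
  by apply: (@cvg_pair _ _ _ F (nbhs a) (nbhs b)).
have [/= da dab] : [set p : M * M | p.1 \in dom d /\ p.2 = d p.1] (a, b).
  refine (@closed_cvg _ _ F FF (fun x => (f x, g x) : M * M) _
    (@der_closed K A d) _ (a, b) Fab).
  by apply: nearW => x /=; split=> //; exact: graph_valP.
apply/cvg_ex; exists (GraphAlgebra ds d1 da : N).
apply/(@cvgrPdist_lt _ _ _ F) => e e0; near=> x.
rewrite distE [e]splitr ltrD//.
  by near: x; move/cvgrPdist_lt: Fa; apply; rewrite divr_gt0.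
rewrite /g/= -dab.
by near: x; move/cvgrPdist_lt: Fb; apply; rewrite divr_gt0.
Unshelve. all: by end_near. Qed.

HB.instance Definition _ :=
  NormedAlgebra_isComplete.Build K D graph_complete.

Fact star_dom (x : D) : star (graph_val x) \in dom d.
Proof. by rewrite ds.1 graph_valP. Qed.
Definition graph_star (x : D) : D := GraphAlgebra ds d1 (star_dom x).

Fact graph_starK : involutive graph_star.
Proof. by move=> x; apply: val_inj; rewrite /= starK. Qed.
Fact graph_starD (x y : D) : graph_star (x + y) = graph_star x + graph_star y.
Proof. by apply: val_inj; rewrite /= starD. Qed.
Fact graph_starZ (c : K) (x : D) : graph_star (c *: x) = c^* *: graph_star x.
Proof. by apply: val_inj; rewrite /= starZ. Qed.
Fact graph_starM (x y : D) : graph_star (x * y) = graph_star y * graph_star x.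
Proof. by apply: val_inj; rewrite /= starM. Qed.
Fact graph_anorm_star (x : D) : anorm (graph_star x) = anorm x.
Proof.
rewrite -[LHS]/(graph_norm d (star (graph_val x))) /graph_norm.
by rewrite ds.2 ?graph_valP// !anorm_star.
Qed.

HB.instance Definition _ := hasInvolution.Build K D
  graph_starK graph_starD graph_starZ graph_starM graph_anorm_star.

End GraphAlgebraTheory.

(* Main.v *)
(** For [a] in the domain [D] of [d], invertible in [A], put [b = a^* a] and
    [x = 1 - b / M] with [M > |b|]. The spectrum of [b] lies in ]0, M[, so that of
    [x] lies in ]0, 1[ and a power of [x] has norm < 1 in [A]. The Leibniz rule
    turns this into a power of graph norm < 1, hence the Neumann series makes
    [1 - x = b / M] invertible in [D], and [a^-1 = b^-1 a^*] is in [D].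

    The existence of the contracting power is the spectral radius formula; it is
    proved without holomorphic functions, by Rickart's argument restricted to the
    powers [x ^ (2 ^ k)], whose resolvents are averages of resolvents of [x]. *)

Require Import Defs.
From mathcomp Require Import all_boot all_order all_algebra.
From mathcomp Require Import all_classical all_reals.
From mathcomp Require Import complex.
From mathcomp Require Import topology normedtype sequences ring lra.
Import Order.TTheory GRing.Theory Num.Theory.
Import numFieldNormedType.Exports.
Local Open Scope ring_scope.
Local Open Scope complex_scope.

Set Implicit Arguments.
Unset Strict Implicit.

(** * The norm as a real number *)

Definition rnorm (R : realType) (A : normedAlgType R[i]) (a : A) : R :=
  complex.Re (anorm a).

Section RealNorm.
Context (R : realType) (A : normedAlgType R[i]).
Implicit Types a b : A.

(** Taking the real part loses nothing, since a nonnegative element of [R[i]] is real. *)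
Lemma rnormE a : anorm a = (rnorm a)%:C.
Proof. by rewrite RRe_real// ger0_real// (@normr_ge0 _ (normed_space A)). Qed.

Lemma rnorm_ge0 a : 0 <= rnorm a.
Proof. by rewrite -ler0c -rnormE (@normr_ge0 _ (normed_space A)). Qed.

Lemma ler_rnormD a b : rnorm (a + b) <= rnorm a + rnorm b.
Proof. by rewrite -lecR rmorphD/= -!rnormE ler_anormD. Qed.

Lemma ler_rnormM a b : rnorm (a * b) <= rnorm a * rnorm b.
Proof. by rewrite -lecR rmorphM/= -!rnormE ler_anormM. Qed.

Lemma rnormZ (c : R[i]) a : rnorm (c *: a) = complex.Re `|c| * rnorm a.
Proof.
apply: complexI.
by rewrite -rnormE anormZ (rnormE a) rmorphM/= (RRe_real (ger0_real (normr_ge0 c))).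
Qed.

Lemma rnormN a : rnorm (- a) = rnorm a.
Proof. by rewrite -scaleN1r rnormZ normrN1 mul1r. Qed.

Lemma rnormB a b : rnorm (a - b) = rnorm (b - a).
Proof. by rewrite -opprB rnormN. Qed.

Lemma rnorm0 : rnorm (0 : A) = 0.
Proof. by rewrite -(scale0r 0) rnormZ normr0 mul0r. Qed.

Lemma rnorm0_eq0 a : rnorm a = 0 -> a = 0.
Proof. by move=> a0; apply: anorm0_eq0; rewrite rnormE a0. Qed.

Lemma rnormX_le a n : rnorm (a ^+ n) <= rnorm (1 : A) * rnorm a ^+ n.
Proof.
elim: n => [|n IHn]; first by rewrite !expr0 mulr1.
rewrite !exprSr mulrA (le_trans (ler_rnormM _ _))// ler_wpM2r ?rnorm_ge0//.
Qed.

Lemma rnormXS_le a n : rnorm (a ^+ n.+1) <= rnorm a ^+ n.+1.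
Proof.
elim: n => [|n IHn]; first by rewrite !expr1.
rewrite exprSr [leRHS]exprSr (le_trans (ler_rnormM _ _))// ler_wpM2r ?rnorm_ge0//.
Qed.

Lemma rnorm_pow2_le a k : rnorm (a ^+ (2 ^ k)) <= rnorm a ^+ (2 ^ k).
Proof. by rewrite -(@prednK (2 ^ k)) ?expn_gt0// rnormXS_le. Qed.

Lemma rnorm_pow2_le1 a k : rnorm a <= 1 -> rnorm (a ^+ (2 ^ k)) <= rnorm a.
Proof.
move=> a1; apply: le_trans (rnorm_pow2_le _ _) _.
rewrite -(@prednK (2 ^ k)) ?expn_gt0// exprS.
by rewrite ler_piMr ?rnorm_ge0// exprn_ile1 ?rnorm_ge0.
Qed.

Lemma rnorm_sub_le a b : rnorm a <= rnorm b + rnorm (a - b).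
Proof. by rewrite -{1}(subrK b a) addrC ler_rnormD. Qed.

Lemma eq_of_rnorm_small a b :
  (forall e : R, 0 < e -> rnorm (a - b) <= e) -> a = b.
Proof.
move=> ab; apply/eqP; rewrite -subr_eq0; apply/eqP/rnorm0_eq0/eqP.
rewrite eq_le rnorm_ge0 andbT; apply/ler_addgt0Pl => e e0; rewrite addr0; exact: ab.
Qed.

End RealNorm.

(** * Geometric convergence and the Neumann series *)

Lemma geometric_eventually_lt (R : realType) (q C e : R) :
  0 <= q -> q < 1 -> 0 < e -> exists N, forall n, (N <= n)%N -> C * q ^+ n < e.
Proof.
move=> q0 q1 e0.
have q1' : `|q| < 1 by rewrite ger0_norm.
have /cvgrPdist_lt/(_ e e0)[N _ NP] := cvg_geometric C q1'.
exists N => n Nn; have := NP n Nn; rewrite /geometric/= sub0r normrN.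
exact: le_lt_trans (ler_norm _).
Qed.

Section Neumann.
Local Open Scope classical_set_scope.
Context (R : realType) (A : banachAlgType R[i]).

Lemma geometric_cvg (u : nat -> A) (C q : R) : 0 <= q -> q < 1 ->
  (forall n, rnorm (u n.+1 - u n) <= C * q ^+ n) ->
  exists l, forall e : R, 0 < e ->
    exists N, forall n, (N <= n)%N -> rnorm (u n - l) < e.
Proof.
move=> q0 q1 uC.
have C0 : 0 <= C by have := uC 0; rewrite expr0 mulr1; apply: le_trans; exact: rnorm_ge0.
(* [D] is the sum of the series C q^n; keeping the exact partial sum in [uD] lets the induction
   close with equality. *)
pose D := C / (1 - q).
have D0 : 0 <= D by rewrite divr_ge0// subr_ge0 ltW.
have uD n m : rnorm (u (n + m)%N - u n) <= D * (q ^+ n - q ^+ (n + m)).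
  elim: m => [|m IHm]; first by rewrite addn0 !subrr rnorm0 mulr0.
  rewrite addnS -(subrKA (u (n + m)%N)).
  apply: (le_trans (ler_rnormD _ _)); apply: (le_trans (lerD (uC _) IHm)).
  rewrite le_eqVlt; apply/orP; left; apply/eqP; rewrite /D exprS; field.
  by rewrite subr_eq0 gt_eqF.
have uN n m : (n <= m)%N -> rnorm (u m - u n) <= D * q ^+ n.
  move=> /subnKC <-; apply: le_trans (uD _ _) _.
  by rewrite ler_wpM2l// gerBl exprn_ge0.
have cu : cauchy ((u : nat -> normed_space A) @ \oo).
  apply/cauchyP => e e0.
  have [|N uN'] := @geometric_eventually_lt R q D (complex.Re e) q0 q1.
    by rewrite -ltcR RRe_real// gtr0_real.
  exists (u N); exists N => // n /= Nn; rewrite -ball_normE/=.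
  change (anorm (u N - u n) < e); rewrite rnormE rnormB -[e]RRe_real ?gtr0_real// ltcR.
  exact: le_lt_trans (uN _ _ Nn) (uN' _ (leqnn _)).
pose v : nat -> normed_space A := u.
have cv : v @ \oo --> lim (v @ \oo) by exact: anorm_complete.
exists (lim (v @ \oo)) => e e0.
have eC : 0 < e%:C by rewrite ltcR.
move/cvgrPdist_lt: cv => /(_ _ eC)[N _ ulN].
exists N => n Nn; rewrite -ltcR rnormB -rnormE; exact: ulN.
Qed.

(** The partial sums [S n] commute with 1 - y and satisfy (1 - y) S_n = 1 - y^n, so their limit is a
    two-sided inverse. *)
Lemma unit_1B (y : A) : rnorm y < 1 -> 1 - y \is a GRing.unit.
Proof.
move=> y1.
pose S n := \sum_(i < n) y ^+ i.
have SE n : (1 - y) * S n = 1 - y ^+ n.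
  by rewrite -[1 in RHS](expr1n _ n) subrXX_comm; last exact: commr_sym (commr1 _);
    congr (_ * _); apply: eq_bigr => i _; rewrite expr1n mul1r.
have Sc n : (1 - y) * S n = S n * (1 - y).
  rewrite mulrBl mulrBr mul1r mulr1 mulr_suml mulr_sumr; congr (_ - _).
  by apply: eq_bigr => i _; rewrite -exprS -exprSr.
have [|g Sg] := @geometric_cvg S (rnorm (1 : A)) (rnorm y) (rnorm_ge0 _) y1.
  by move=> n; rewrite /S big_ord_recr/= addrAC subrr add0r rnormX_le.
pose c := rnorm (1 - y) + 1.
have c0 : 0 < c by rewrite ltr_wpDl// rnorm_ge0.
have key e : 0 < e -> exists n, rnorm (1 - y) * rnorm (S n - g) + rnorm (y ^+ n) <= e.
  move=> e0.
  have [N NP] : exists N, forall n, (N <= n)%N -> rnorm (S n - g) < e / 2 / c.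
    by apply: Sg; rewrite !divr_gt0.
  have [|M MP] := @geometric_eventually_lt R (rnorm y) (rnorm (1 : A)) (e / 2)
    (rnorm_ge0 _) y1.
    by rewrite divr_gt0.
  exists (maxn N M); rewrite [e]splitr lerD//.
    have := NP _ (leq_maxl N M); rewrite ltr_pdivlMr// mulrC => /ltW; apply: le_trans.
    by rewrite ler_wpM2r ?rnorm_ge0// lerDl.
  exact: le_trans (rnormX_le _ _) (ltW (MP _ (leq_maxr N M))).
apply/unitrP; exists g; split; apply: eq_of_rnorm_small => e /key[n]; apply: le_trans.
- have -> : g * (1 - y) - 1 = - ((S n - g) * (1 - y) + y ^+ n).
    by rewrite mulrBl -Sc SE addrAC subrK opprB.
  rewrite rnormN (le_trans (ler_rnormD _ _))// lerD2r mulrC.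
  exact: ler_rnormM.
- have -> : (1 - y) * g - 1 = - ((1 - y) * (S n - g) + y ^+ n).
    by rewrite mulrBr SE addrAC subrK opprB.
  rewrite rnormN (le_trans (ler_rnormD _ _))// lerD2r.
  exact: ler_rnormM.
Qed.

End Neumann.

(** * Complex moduli and identities for inverses *)

Lemma norm_complex_le (R : realType) (s t : R) :
  complex.Re `|s +i* t| <= `|s| + `|t|.
Proof.
rewrite normc_def/= -ler_sqr ?nnegrE ?addr_ge0 ?sqrtr_ge0//.
rewrite sqr_sqrtr ?addr_ge0 ?sqr_ge0//.
by rewrite sqrrD !real_normK ?num_real// lerD2r lerDl mulrn_wge0 ?mulr_ge0.
Qed.

Lemma Re_norm_realM (R : realType) (r : R) (u : R[i]) :
  `|u| = 1 -> complex.Re `|r%:C * u| = `|r|.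
Proof. by move=> u1; rewrite normrM u1 mulr1 normc_def/= expr0n addr0 sqrtr_sqr. Qed.

Lemma invr_sub (A : unitRingType) (u v : A) :
  u \is a GRing.unit -> v \is a GRing.unit -> u^-1 - v^-1 = u^-1 * (v - u) * v^-1.
Proof. by move=> uu uv; rewrite mulrBr mulVr// mulrBl mulrK// mul1r. Qed.

Lemma subr_1_sqr (A : pzRingType) (y : A) : 1 - y ^+ 2 = (1 - y) * (1 + y).
Proof. by rewrite mulrBl !mulrDr !mulr1 mul1r opprD addrA addrK. Qed.

Lemma subr_1_sqrC (A : pzRingType) (y : A) : 1 - y ^+ 2 = (1 + y) * (1 - y).
Proof. by rewrite mulrDl !mulrBr !mulr1 mul1r addrA subrK. Qed.

Lemma unit_1Bsqr (A : unitRingType) (y : A) :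
  1 - y \is a GRing.unit -> 1 + y \is a GRing.unit -> 1 - y ^+ 2 \is a GRing.unit.
Proof.
by move=> u1 u2; rewrite subr_1_sqr unitrMl.
Qed.

Lemma invr_1Bsqr (K : numFieldType) (A : unitAlgType K) (y : A) :
  1 - y \is a GRing.unit -> 1 + y \is a GRing.unit ->
  (1 - y ^+ 2)^-1 = 2^-1 *: ((1 - y)^-1 + (1 + y)^-1).
Proof.
move=> u1 u2; have u := unit_1Bsqr u1 u2; apply: (mulrI u).
rewrite mulrV// -scalerAr mulrDr.
rewrite {1}subr_1_sqrC subr_1_sqr !mulrK// addrACA subrr addr0.
by rewrite -mulr2n -scalerMnr scalerMnl -mulr_natr mulVf ?scale1r ?pnatr_eq0.
Qed.

(** * Resolvents and the existence of a contracting power *)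

Section SpectralRadius.
Context (R : realType) (A : banachAlgType R[i]) (x : A).
Context (ux : forall s t : R, `|s| <= 1 -> `|t| <= 1 ->
  1 - (s +i* t) *: x \is a GRing.unit).

Lemma resolvent_dist_le (z z' : R[i]) :
  1 - z *: x \is a GRing.unit -> 1 - z' *: x \is a GRing.unit ->
  rnorm ((1 - z *: x)^-1 - (1 - z' *: x)^-1) <=
    complex.Re `|z - z'| * rnorm x * (rnorm (1 - z *: x)^-1 * rnorm (1 - z' *: x)^-1).
Proof.
move=> uz uz'; rewrite invr_sub//.
have -> : 1 - z' *: x - (1 - z *: x) = (z - z') *: x.
  by rewrite opprB addrC addrA subrK scalerBl.
apply: le_trans (ler_rnormM _ _) _; rewrite mulrA ler_wpM2r ?rnorm_ge0//.
by apply: le_trans (ler_rnormM _ _) _; rewrite rnormZ mulrC.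
Qed.

(** The square is compact and contains the closed unit disc; the resolvent identity gives a bound
    near each point, and compactness makes it uniform. *)
Lemma resolvent_bounded : exists2 L : R, 0 <= L &
  forall s t : R, `|s| <= 1 -> `|t| <= 1 -> rnorm (1 - (s +i* t) *: x)^-1 <= L.
Proof.
pose K := (`[-1 : R, 1] `*` `[-1 : R, 1])%classic.
pose f (p : R * R) := rnorm (1 - (p.1 +i* p.2) *: x)^-1.
have cK : compact K by apply: compact_setX; exact: segment_compact.
have KP p : K p -> 1 - (p.1 +i* p.2) *: x \is a GRing.unit.
  by move=> [/=]; rewrite !in_itv/= -!ler_norml => ? ?; exact: ux.
have /compact_near_coveringP/near_covering_withinP H := cK.
have [] := H R (pinfty_nbhs R) (fun L p => f p <= L) _.
  move=> p Kp /=.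
  pose c := f p * rnorm x.
  have c0 : 0 <= c by rewrite mulr_ge0 ?rnorm_ge0.
  (* Two coordinate errors of this size give |q - p| c <= 1/2; the added 1 keeps the divisor
     positive. *)
  have e0 : 0 < (4 * (c + 1))^-1 by rewrite invr_gt0 mulr_gt0// ltr_wpDl.
  have B : \forall q \near p, `|q.1 - p.1| <= (4 * (c + 1))^-1 /\
                                `|q.2 - p.2| <= (4 * (c + 1))^-1.
    apply: filterS (nbhsx_ballx p _ e0) => q [].
    by rewrite -!ball_normE/= => /ltW q1 /ltW q2; split; rewrite distrC.
  near=> q L => /= Kq.
  have pq : complex.Re `|q.1 +i* q.2 - p.1 +i* p.2| * c <= 1 / 2.
    apply: (@le_trans _ _ ((`|q.1 - p.1| + `|q.2 - p.2|) * c)).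
      by rewrite ler_wpM2r// norm_complex_le.
    have [q1 q2] : `|q.1 - p.1| <= (4 * (c + 1))^-1 /\
                   `|q.2 - p.2| <= (4 * (c + 1))^-1 by near: q.
    rewrite (le_trans (ler_wpM2r c0 (lerD q1 q2)))//.
    have -> : (4 * (c + 1))^-1 + (4 * (c + 1))^-1 = 1 / 2 / (c + 1).
      by field; rewrite gt_eqF// ltr_wpDl.
    by rewrite mulrAC ler_pdivrMr ?ltr_wpDl//; lra.
  (* The bound contains [f q] itself with coefficient at most 1/2; absorbing it yields f q <= 2 f
     p. *)
  have fq : f q <= f p + f p * rnorm x * complex.Re `|q.1 +i* q.2 - p.1 +i* p.2| * f q.
    apply: le_trans (rnorm_sub_le _ ((1 - (p.1 +i* p.2) *: x)^-1)) _; rewrite lerD2l.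
    apply: le_trans (resolvent_dist_le _ _) _; rewrite ?KP// -/(f p) -/(f q).
    by rewrite le_eqVlt; apply/orP; left; apply/eqP; ring.
  apply: (@le_trans _ _ (2 * f p)).
    have : 0 <= f q by exact: rnorm_ge0.
    rewrite -/c in fq; nra.
  by rewrite /=; near: L; apply: nbhs_pinfty_ge; exact: num_real.
(* The bound holds only strictly above the threshold [L], hence [L + 1]. *)
move=> L [_ HL]; exists `|L + 1| => // s t s1 t1.
have LL : L < L + 1 by rewrite ltrDl.
apply: le_trans (ler_norm _); apply: (HL _ LL (s, t)).
by split; rewrite /= in_itv/= -ler_norml.
Unshelve. all: by end_near. Qed.

(* The resolvents of the 2^k-th powers: (1 - y^2)^-1 is the mean of (1 - y)^-1
   and (1 + y)^-1, and -y is again of the form y k w s because the 2^k-th roots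
   of -1 exist, so one Lipschitz constant serves every k. *)
Let y k (u : R[i]) (s : R) := ((s%:C * u) *: x) ^+ (2 ^ k).

Lemma iter_resolvent_lipschitz : exists2 L : R, 0 <= L &
  forall k (u : R[i]) (s t : R), `|u| = 1 -> 0 <= s <= 1 -> 0 <= t <= 1 ->
    1 - y k u s \is a GRing.unit /\
    rnorm ((1 - y k u s)^-1 - (1 - y k u t)^-1) <= L * `|s - t|.
Proof.
have [M M0 xM] := resolvent_bounded.
exists (M * rnorm x * M) => [|k]; first by rewrite !mulr_ge0 ?rnorm_ge0.
elim: k => [|k IHk] u s t u1 s01 t01.
  have bnd r : 0 <= r <= 1 -> 1 - (r%:C * u) *: x \is a GRing.unit /\
      rnorm (1 - (r%:C * u) *: x)^-1 <= M.
    move=> /andP[r0 r1].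
    have : `|r%:C * u| <= 1.
      by rewrite normrM u1 mulr1 normc_def/= expr0n addr0 sqrtr_sqr ger0_norm// lecR.
    case: (_ * u) => a b; rewrite normc_def/= -[1]/(1%:C) lecR => ab1.
    have [a1 b1] : `|a| <= 1 /\ `|b| <= 1.
      split; apply: le_trans ab1; rewrite -sqrtr_sqr ler_sqrt ?addr_ge0 ?sqr_ge0//.
        by rewrite lerDl sqr_ge0.
      by rewrite lerDr sqr_ge0.
    by split; [exact: ux | exact: xM].
  have [us Ms] := bnd _ s01; have [ut Mt] := bnd _ t01.
  rewrite /y expn0 !expr1; split=> //.
  apply: le_trans (resolvent_dist_le us ut) _.
  rewrite -mulrBl -(rmorphB (real_complex R)) Re_norm_realM//.
  have -> : M * rnorm x * M * `|s - t| = `|s - t| * rnorm x * (M * M) by ring.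
  by rewrite ler_wpM2l ?mulr_ge0 ?rnorm_ge0// ler_pM ?rnorm_ge0.
pose n := (2 ^ k)%N.
have n0 : (0 < n)%N by rewrite expn_gt0.
pose w : R[i] := n.-root (-1) * u.
have w1 : `|w| = 1.
  rewrite normrM u1 mulr1; apply/eqP.
  by rewrite -(pexpr_eq1 n0)// -normrX rootCK// normrN1.
have yS r : y k.+1 u r = y k u r ^+ 2 by rewrite /y expnSr exprM.
have yN r : - y k u r = y k w r.
  by rewrite /y /w mulrCA -[in RHS]scalerA [RHS]exprZn -/n rootCK// scaleN1r.
have [us us_st] := IHk u s t u1 s01 t01.
have [ws ws_st] := IHk w s t w1 s01 t01.
(* The induction hypothesis asserts invertibility at its first parameter only; exchanging s and t
   gives it at t. *)
have [ut _] := IHk u t s u1 t01 s01.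
have [wt _] := IHk w t s w1 t01 s01.
rewrite -!yN !opprK in ws wt ws_st.
rewrite !yS; split; first exact: unit_1Bsqr.
rewrite !invr_1Bsqr// -scalerBr opprD addrACA rnormZ.
rewrite normfV normr_nat.
have -> : complex.Re (2^-1 : R[i]) = 2^-1.
  by have -> : (2^-1 : R[i]) = (2^-1 : R)%:C by rewrite fmorphV rmorph_nat.
rewrite ler_pdivrMl// (le_trans (ler_rnormD _ _))// (le_trans (lerD us_st ws_st))//.
by rewrite mulr2n mulrDl mul1r.
Qed.

(** A small z has its resolvent (1 - z)^-1 near 1 ([small]), and a resolvent near 1 forces |z| < 1
    ([near1]). Between these two facts the Lipschitz bound moves the parameter s. *)
Lemma pow2_contraction : exists k, rnorm (x ^+ (2 ^ k)) < 1.
Proof.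
have [L L0 lipL] := iter_resolvent_lipschitz.
pose c := rnorm (1 : A).
have c0 : 0 <= c by exact: rnorm_ge0.
(* With this [e], |z| <= e (c + |z|) gives |z| <= c / (c + 1) < 1. *)
pose e := (c + 2)^-1.
have e0 : 0 < e by rewrite invr_gt0 ltr_wpDl.
have near1 (z : A) : 1 - z \is a GRing.unit -> rnorm ((1 - z)^-1 - 1) <= e ->
    rnorm z < 1.
  move=> uz ze.
  have zE : z = ((1 - z)^-1 - 1) * (1 - z) by rewrite mulrBl mulVr// mul1r subKr.
  have := ler_rnormM ((1 - z)^-1 - 1) (1 - z); rewrite -zE => z1.
  have := ler_rnormD 1 (- z); rewrite rnormN -/c => z2.
  have z0 := rnorm_ge0 z.
  have ec : e * (c + 2) = 1 by rewrite mulVf// gt_eqF// ltr_wpDl.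
  have : rnorm z <= e * (c + rnorm z).
    apply: le_trans z1 _; exact: ler_pM (rnorm_ge0 _) (rnorm_ge0 _) ze z2.
  nra.
(* For |z| <= 1/2 the resolvent g = 1 + z g satisfies |g| <= c + |g| / 2, so |g| <= 2 c. *)
have small (z : A) : 1 - z \is a GRing.unit -> rnorm z <= 2^-1 ->
    rnorm ((1 - z)^-1 - 1) <= rnorm z * (2 * c).
  move=> uz z1.
  have zE : (1 - z)^-1 - 1 = z * (1 - z)^-1.
    by apply: (mulIr uz); rewrite mulrBl mulVr// mul1r mulrVK// subKr.
  have g1 := ler_rnormM z ((1 - z)^-1).
  have := rnorm_sub_le ((1 - z)^-1) 1; rewrite zE -/c => g2.
  have g0 := rnorm_ge0 ((1 - z)^-1).
  have z0 := rnorm_ge0 z; have zg := ler_wpM2r g0 z1.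
  apply: (le_trans g1); rewrite ler_wpM2l//; lra.
pose N := (Num.truncn (2 * L / e)).+1.
have NL : L * N%:R^-1 <= e / 2.
  have : 2 * L / e < N%:R by exact: truncnS_gt.
  rewrite ltr_pdivrMr// ler_pdivrMr ?ltr0n// mulrAC ler_pdivlMr//.
  by rewrite mulrC (mulrC e) => /ltW.
(* The Lipschitz constant being uniform in the exponent, contractivity of
   s *: x propagates from s = 0 to s = 1 in N steps of length 1 / N. *)
have x0 j : (j <= N)%N -> exists k, rnorm (y k 1 (j%:R / N%:R)) < 1.
  elim: j => [_|j IHj jN].
    by exists 0; rewrite /y mul0r mul0r scale0r expn0 expr1 rnorm0.
  have [k yk] := IHj (ltnW jN).
  have s01 i : (i <= N)%N -> 0 <= (i%:R / N%:R : R) <= 1.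
    by move=> iN; rewrite divr_ge0//= ler_pdivrMr ?ltr0n// mul1r ler_nat.
  have js := s01 _ (ltnW jN); have js1 := s01 _ jN.
  (* The first bound is the hypothesis of [small]; the second makes its conclusion at most e / 2,
     and the Lipschitz step costs the other e / 2. *)
  have d0 : 0 < Num.min (2^-1) (e / 2 / (2 * c + 1)).
    by rewrite lt_min invr_gt0 ltr0n/= !divr_gt0// ltr_wpDl ?mulr_ge0.
  have [m mP] := @geometric_eventually_lt R _ 1 _ (rnorm_ge0 _) yk d0.
  pose K := (k + m)%N.
  have yK : rnorm (y K 1 (j%:R / N%:R)) <= Num.min (2^-1) (e / 2 / (2 * c + 1)).
    rewrite /y expnD exprM -/(y k _ _).
    apply: le_trans (rnorm_pow2_le _ _) _.
    have := mP (2 ^ m)%N (ltnW (ltn_expl _ (ltnSn 1))).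
    by rewrite mul1r => /ltW.
  have [uj jj1] := lipL K 1 _ _ (normr1 _) js js1.
  have [uj1 _] := lipL K 1 _ _ (normr1 _) js1 js.
  exists K; apply: near1 => //.
  move: yK; rewrite le_min => /andP[yK1 yK2].
  have := small _ uj yK1 => s1.
  apply: le_trans (rnorm_sub_le _ ((1 - y K 1 (j%:R / N%:R))^-1 - 1)) _.
  rewrite [e]splitr; apply: lerD.
    apply: le_trans s1 _; move: yK2; rewrite ler_pdivlMr ?ltr_wpDl ?mulr_ge0//.
    by have := rnorm_ge0 (y K 1 (j%:R / N%:R)); nra.
  rewrite opprB addrA subrK rnormB; apply: le_trans jj1 _.
  by rewrite distrC -mulrBl -natrB ?leqnSn// subSnn mul1r ger0_norm ?invr_ge0.
have [k] := x0 N (leqnn _).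
by rewrite divff ?pnatr_eq0// /y mul1r scale1r => xk; exists k.
Qed.

End SpectralRadius.

(** * Units, the involution and the spectrum of b *)

(** The factors of 1 - y^2 = (1 - y)(1 + y) commute, so both are units when the product is. *)
Lemma unit_1B_pow2 (A : unitRingType) (x : A) k :
  1 - x ^+ (2 ^ k) \is a GRing.unit -> 1 - x \is a GRing.unit.
Proof.
elim: k => [|k IHk]; first by rewrite expn0 expr1.
rewrite expnSr exprM => u; apply: IHk; move: u; set y := x ^+ (2 ^ k).
rewrite subr_1_sqr unitrM_comm; first by case/andP.
by apply: commrD; [exact: commr1 | apply/commr_sym/commrB; [exact: commr1|]].
Qed.

Lemma star1 (K : numClosedFieldType) (A : banachStarAlgType K) : star 1 = 1 :> A.
Proof. by have := starM (star 1) (1 : A); rewrite mulr1 starK mulr1. Qed.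

Lemma star_unit (K : numClosedFieldType) (A : banachStarAlgType K) (a : A) :
  a \is a GRing.unit -> star a \is a GRing.unit.
Proof.
move=> ua; apply/unitrP; exists (star a^-1).
by rewrite -!starM mulrV// mulVr// star1.
Qed.

(* If 1 - l (1 - b / M) were singular, M (1 - 1 / l) would be in the spectrum of
   b, which is contained in ]0, M[; so l would be a real number > 1. *)
Lemma unit_spectrum_square (R : realType) (A : banachAlgType R[i]) (b : A) (M : R) :
  (spectrum b `<=` [set z | 0 <= z])%classic -> b \is a GRing.unit ->
  rnorm b < M -> forall s t : R, `|s| <= 1 -> `|t| <= 1 ->
  1 - (s +i* t) *: (1 - (M%:C)^-1 *: b) \is a GRing.unit.
Proof.
move=> sb ub bM s t s1 _; set l := s +i* t.
have M0 : 0 < M by exact: le_lt_trans (rnorm_ge0 _) bM.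
have MC0 : M%:C != 0 by rewrite (fmorph_eq0 (real_complex R)) gt_eqF.
have [l0|l0] := eqVneq l 0; first by rewrite l0 scale0r subr0 unitr1.
pose z := M%:C * (l - 1) / l.
have -> : 1 - l *: (1 - (M%:C)^-1 *: b) = (l / M%:C) *: (b - z%:A).
  rewrite !scalerBr !scalerA /z.
  have -> : l / M%:C * (M%:C * (l - 1) / l) = l - 1 by field; rewrite l0.
  by rewrite scalerBl scale1r !opprB addrC addrA addrAC.
rewrite scaler_unit ?unitfE ?mulf_neq0 ?invr_eq0//.
apply: contraT => nu; have /= z0 := sb z nu.
pose r := complex.Re z.
have zr : z = r%:C by rewrite RRe_real// ger0_real.
have r0 : 0 <= r by rewrite -ler0c -zr.
(* Beyond |b| the Neumann series makes b - z invertible, against the choice of z. *)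
have [rM|rM] := ltP (rnorm b) r.
  have rC0 : r%:C != 0.
    by rewrite (fmorph_eq0 (real_complex R)) gt_eqF// (le_lt_trans (rnorm_ge0 _) rM).
  move: nu; have -> : b - z%:A = (- r%:C) *: (1 - (r%:C)^-1 *: b).
    by rewrite scalerBr scalerA mulNr divff// scaleN1r opprK zr scaleNr addrC.
  rewrite scaler_unit ?unitfE ?oppr_eq0// unit_1B//.
  rewrite rnormZ.
  have -> : complex.Re `|(r%:C)^-1| = `|r^-1|.
    by rewrite -(fmorphV (real_complex R)) -[X in `|X|]mulr1 Re_norm_realM ?normr1.
  by rewrite ger0_norm ?invr_ge0// mulrC ltr_pdivrMr ?mul1r//
    (le_lt_trans (rnorm_ge0 _) rM).
(* Now r < M, and real parts give s (M - r) = M; since s <= 1 this forces r = 0, and then b would be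
   singular. *)
have : l * (M - r)%:C = M%:C.
  have -> : (M - r)%:C = M%:C - z by rewrite zr (rmorphB (real_complex R)).
  by rewrite /z; field.
move=> /(congr1 (@complex.Re R)); rewrite /l/= mulr0 subr0 => sM.
have r00 : r = 0.
  apply/eqP; rewrite eq_le r0 andbT; move: s1; rewrite ler_norml => /andP[_ s1].
  nra.
by move: nu; rewrite zr r00 scale0r subr0 ub.
Qed.

(** * Inverse-closedness of the domain, symmetry and the quotient rule *)

Section Domain.
Context (R : realType) (A : banachStarAlgType R[i]) (d : derivation A).
Context (ds : symmetric_derivation d) (d1 : 1 \in dom d).
Local Notation D := (graph_algebra ds d1).

Lemma graph_rnormE (x : D) : rnorm x = rnorm (val x) + rnorm (d (val x)).
Proof. by apply: complexI; rewrite (rmorphD (real_complex R))/= -!rnormE. Qed.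

Lemma domX a n : a \in dom d -> a ^+ n \in dom d.
Proof. by move=> da; elim: n => [|n IHn]; rewrite ?expr0// exprS domM. Qed.

(* By the Leibniz rule |d (b^2)| <= 2 |b| |d b|, so each squaring halves the
   derivative as soon as |b| <= 1/4. *)
Lemma rnorm_der_pow2 (a : A) m : a \in dom d -> rnorm a <= 4^-1 ->
  rnorm (d (a ^+ (2 ^ m))) <= rnorm (d a) * (2^-1) ^+ m.
Proof.
move=> da a4; elim: m => [|m IHm]; first by rewrite expn0 !expr1 expr0 mulr1.
have a4m : rnorm (a ^+ (2 ^ m)) <= 4^-1.
  apply: (le_trans _ a4); apply: rnorm_pow2_le1; lra.
rewrite expnSr exprM expr2 derM ?domX//; set b := a ^+ (2 ^ m).
apply: le_trans (ler_rnormD _ _) _.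
have := ler_rnormM b (d b); have := ler_rnormM (d b) b.
have := ler_wpM2l (rnorm_ge0 (d b)) a4m; rewrite -/b (mulrC _ (rnorm b)).
rewrite exprSr mulrA; move: IHm; rewrite -/b; lra.
Qed.

(** Squaring first brings the norm in [A] down to 1/4; further squarings then bring the derivative
    below 1/4, and the graph norm is the sum. *)
Lemma graph_rnorm_pow2_lt1 (y : D) : rnorm (val y) < 1 ->
  exists m, rnorm (y ^+ (2 ^ m)) < 1.
Proof.
move=> y1.
have q4 : 0 < 4^-1 :> R by rewrite invr_gt0.
have [n nP] := @geometric_eventually_lt R _ 1 _ (rnorm_ge0 _) y1 q4.
pose z := y ^+ (2 ^ n).
have z4 : rnorm (val z) <= 4^-1.
  rewrite rmorphXn/=; apply: le_trans (rnorm_pow2_le _ _) _.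
  by have := nP (2 ^ n)%N (ltnW (ltn_expl _ (ltnSn 1))); rewrite mul1r => /ltW.
have h0 : 0 <= 2^-1 :> R by rewrite invr_ge0.
have h1 : 2^-1 < 1 :> R by rewrite invf_lt1// ltr1n.
have [m mP] := @geometric_eventually_lt R _ (rnorm (d (val z))) _ h0 h1 q4.
exists (n + m)%N; rewrite expnD exprM -/z graph_rnormE rmorphXn/=.
have dz := @rnorm_der_pow2 _ m (valP z) z4.
have := mP _ (leqnn _).
have z4m : rnorm (val z ^+ (2 ^ m)) <= 4^-1.
  apply: (le_trans _ z4); apply: rnorm_pow2_le1; lra.
move: dz z4m; rewrite /=; lra.
Qed.

Lemma dom_inverse_closed : symmetric_algebra A -> inverse_closed (dom d).
Proof.
move=> symA a da ua.
pose x : D := GraphAlgebra ds d1 da.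
pose b : D := star x * x.
have bE : val b = star a * a by rewrite rmorphM.
have ub : val b \is a GRing.unit by rewrite bE unitrMl ?star_unit.
pose M := rnorm (val b) + 1.
have bM : rnorm (val b) < M by rewrite ltrDl.
have sb : (spectrum (val b) `<=` [set z | 0 <= z])%classic by rewrite bE; exact: symA.
have [k ck] := pow2_contraction (unit_spectrum_square sb ub bM).
pose y : D := 1 - (M%:C)^-1 *: b.
have yE : val y = 1 - (M%:C)^-1 *: val b.
  by rewrite rmorphB.
(* The exponent [k] contracts in the norm of [A]; the further exponent [m] contracts in the graph
   norm. *)
have [m cm] : exists m, rnorm ((y ^+ (2 ^ k)) ^+ (2 ^ m)) < 1.
  by apply: graph_rnorm_pow2_lt1; rewrite rmorphXn -[X in X ^+ _]/(val y) yE.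
have : 1 - y \is a GRing.unit.
  apply: (@unit_1B_pow2 _ _ (k + m)); rewrite expnD exprM; exact: unit_1B.
rewrite /y subKr => uMb.
have /unitrP[c [cb _]] := uMb.
(* A left inverse lying in [D] suffices: a is invertible in [A], so it equals a^-1. *)
have ca : val ((M%:C)^-1 *: (c * star x)) * a = 1.
  rewrite -[a]/(val x) -rmorphM -[RHS]/(val (1 : D)) -cb.
  by rewrite -scalerAl -scalerAr mulrA.
suff -> : a^-1 = val ((M%:C)^-1 *: (c * star x)) by exact: valP.
by apply: (mulIr ua); rewrite mulVr.
Qed.

(** By inverse-closedness, an element of [D] invertible in [A] is invertible in [D], so passing to
    [D] does not enlarge spectra. *)
Lemma graph_symmetric : symmetric_algebra A -> symmetric_algebra D.
Proof.
move=> symA x z nu; apply: (symA (val x)); apply: contra nu => u.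
have dV : (star (val x) * val x - z%:A)^-1 \in dom d.
  apply: dom_inverse_closed u => //.
  exact: (valP (star x * x - z%:A)).
apply/unitrP; exists (GraphAlgebra ds d1 dV).
by split; apply: val_inj; rewrite rmorphM rmorph1 /= ?mulVr ?mulrV.
Qed.

Lemma der1 : d 1 = 0.
Proof.
have := derM d1 d1; rewrite !mulr1 mul1r => /eqP.
by rewrite -{1}[d 1]addr0 (inj_eq (addrI _)) eq_sym => /eqP.
Qed.

(** The Leibniz rule applied to a a^-1 = 1, where d(1) = 0. *)
Lemma derV a : a \in dom d -> a^-1 \in dom d -> a \is a GRing.unit ->
  d a^-1 = - (a^-1 * d a * a^-1).
Proof.
move=> da dV ua; have := derM da dV; rewrite mulrV// der1 => /eqP.
rewrite eq_sym addr_eq0 => /eqP E.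
by apply: (mulrI ua); rewrite E mulrN !mulrA mulrV// mul1r.
Qed.

Lemma graph_norm_inv_le a : a \is a GRing.unit ->
  d a^-1 = - (a^-1 * d a * a^-1) ->
  graph_norm d a^-1 <= anorm a^-1 ^+ 2 * graph_norm d a.
Proof.
move=> ua dV; rewrite /graph_norm dV !rnormE rnormN.
rewrite -!(rmorphD (real_complex R)) -(rmorphXn (real_complex R)).
rewrite -(rmorphM (real_complex R)).
rewrite lecR mulrDr.
have sandwich b : rnorm (a^-1 * b * a^-1) <= rnorm a^-1 ^+ 2 * rnorm b.
  rewrite expr2 mulrAC (le_trans (ler_rnormM _ _))// ler_wpM2r ?rnorm_ge0//.
  exact: ler_rnormM.
(* The case b = a of [sandwich] bounds a^-1 = a^-1 a a^-1 itself, with no factor |1|. *)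
by apply: lerD => //; have := sandwich a; rewrite mulVr// mul1r.
Qed.

End Domain.

Theorem theorem3p4 (R : realType) (A : banachStarAlgType R[i])
    (symA : symmetric_algebra A)
    (d : derivation A) (ds : symmetric_derivation d) (d1 : 1 \in dom d) :
  [/\ inverse_closed (dom d),
      symmetric_algebra (graph_algebra ds d1)
    & forall a : A, a \in dom d -> a \is a GRing.unit ->
        d a^-1 = - (a^-1 * d a * a^-1) /\
        graph_norm d a^-1 <= anorm a^-1 ^+ 2 * graph_norm d a].
Proof.
have ic := dom_inverse_closed ds d1 symA.
split=> // [|a da ua]; first exact: graph_symmetric.
have dV := derV d1 da (ic a da ua) ua.
by split=> //; exact: graph_norm_inv_le.
Qed.
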